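(* For every integer $k\geq 2$, the sequences (indexed by odd primes $p$) \[ p^k\sum_{n=1}^{(p-1)/2}\frac{1}{n^k}\qquad\text{and}\qquad p^k\sum_{n=1}^{p-1}\frac{(-1)^n}{n^k} \] are in the weighted MHS algebra.
   Context: A composition is a finite list $\mathbf{s}=(s_1,\ldots,s_j)$ of positive integers with weight $|\mathbf{s}|=s_1+\cdots+s_j$; $H_N(\mathbf{s})=\sum_{N\ge n_1>\cdots>n_j\ge1}\frac{1}{n_1^{s_1}\cdots n_j^{s_j}}$ and $h_p(\mathbf{s})=p^{|\mathbf{s}|}H_{p-1}(\mathbf{s})$. Let $\mathbb{Q}_{p\to\infty}$ be the quotient of the ring of sequences $(a_p)_p\in\prod_p\mathbb{Q}_p$ with $v_p(a_p)$ bounded below, by the ideal of sequences with $v_p(a_p)\to\infty$ (quantities defined for all but finitely many $p$ give elements). The weighted MHS algebra is the set of $(a_p)$ for which there exist rationals $c_i$ and compositions $\mathbf{s}_i$ with $|\mathbf{s}_i|\to\infty$, independent of $p$, such that for every integer $n$, $a_p\equiv\sum_{|\mathbf{s}_i|<n}c_ih_p(\mathbf{s}_i)\pmod{p^n}$ for all sufficiently large $p$. *)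

(* Defs.v *)
From HB Require Import structures.
From mathcomp Require Import all_boot all_order all_algebra.
From mathcomp Require Import ring_quotient generic_quotient.
From mathcomp Require Import boolp classical_sets functions cardinality fsbigop.
Set Implicit Arguments.
Unset Strict Implicit.
Unset Printing Implicit Defensive.
Import Order.TTheory GRing.Theory Num.Theory.
Local Open Scope ring_scope.
Local Open Scope quotient_scope.
Local Open Scope classical_set_scope.

Record prime_number := PrimeNumber {
  prime_val :> nat;
  prime_valP : prime prime_val }.

Definition for_almost_all_primes (P : prime_number -> Prop) : Prop :=
  exists N : nat, forall p : prime_number, (N <= p)%N -> P p.

Lemma for_almost_all_primesI (P Q R : prime_number -> Prop) :
    (forall p, P p -> Q p -> R p) -> for_almost_all_primes P ->
  for_almost_all_primes Q -> for_almost_all_primes R.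
Proof.
move=> h [N hN] [M hM]; exists (maxn N M) => p.
by rewrite geq_max => /andP[/hN hP /hM]; exact: h.
Qed.

Lemma for_almost_all_primesW (P Q : prime_number -> Prop) :
    (forall p, P p -> Q p) -> for_almost_all_primes P ->
  for_almost_all_primes Q.
Proof. by move=> h [N hN]; exists N => p /hN/h. Qed.

(* Meaningful for [x != 0] only. *)
Definition ratval (p : nat) (x : rat) : int :=
  (logn p `|numq x|)%:Z - (logn p `|denq x|)%:Z.

(* n <= v_p(x), with the convention v_p(0) = +oo *)
Definition ratval_ge (p : nat) (n : int) (x : rat) : bool :=
  (x == 0) || (n <= ratval p x).

Section RatVal.
Variable p : prime_number.
Implicit Types (m n : int) (x y : rat).

Lemma ratval_frac (a d : int) : a != 0 -> d != 0 ->
  ratval p (a%:~R / d%:~R) = (logn p `|a|)%:Z - (logn p `|d|)%:Z.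
Proof.
move=> a0 d0; set x := a%:~R / d%:~R.
have x0 : x != 0 by rewrite mulf_neq0 ?invr_eq0 ?intr_eq0.
have e : numq x * d = a * denq x.
  apply: (@intr_inj rat); rewrite !intrM; apply/eqP.
  by rewrite -eqr_div ?intr_eq0 ?denq_neq0 // divq_num_den.
have := congr1 (fun z : int => logn p `|z|%N) e.
rewrite !abszM !lognM ?absz_gt0 ?numq_eq0 ?denq_neq0 // => /(congr1 Posz).
rewrite !PoszD /ratval => h.
by apply/eqP; rewrite subr_eq addrAC eq_sym subr_eq eq_sym h.
Qed.

Lemma ratvalM x y : x != 0 -> y != 0 ->
  ratval p (x * y) = ratval p x + ratval p y.
Proof.
move=> x0 y0; rewrite -{1}(divq_num_den x) -{1}(divq_num_den y) mulf_div -!intrM.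
rewrite ratval_frac ?mulf_neq0 ?numq_eq0 ?denq_neq0 // !abszM.
rewrite !lognM ?absz_gt0 ?numq_eq0 ?denq_neq0 // !PoszD /ratval.
by rewrite opprD addrACA.
Qed.

Lemma ratval1 : ratval p 1 = 0.
Proof. by rewrite -[1]/(1%:~R) /ratval numq_int denq_int subrr. Qed.

Lemma ratval_ge_frac n (a d : int) : d != 0 ->
  ratval_ge p n (a%:~R / d%:~R) =
  if n + (logn p `|d|)%:Z is Posz m then (p ^ m %| `|a|)%N else true.
Proof.
move=> d0; rewrite /ratval_ge mulf_eq0 invr_eq0 !intr_eq0 (negPf d0) orbF.
have [->|a0] := eqVneq a 0; first by case: (_ + _) => // m; rewrite dvdn0.
rewrite ratval_frac //= lerBrDr; case: (_ + _) => // m.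
by rewrite lez_nat pfactor_dvdn ?absz_gt0 ?prime_valP.
Qed.

Lemma ratval_ge0 n : ratval_ge p n 0.
Proof. by rewrite /ratval_ge eqxx. Qed.

Lemma ratval_ge1 n : ratval_ge p n 1 = (n <= 0).
Proof. by rewrite /ratval_ge oner_eq0 ratval1. Qed.

Lemma ratval_ge_le m n x : m <= n -> ratval_ge p n x -> ratval_ge p m x.
Proof.
by move=> mn /orP[/eqP->|h]; rewrite /ratval_ge ?eqxx // (le_trans mn h) orbT.
Qed.

Lemma ratval_geM m n x y :
  ratval_ge p m x -> ratval_ge p n y -> ratval_ge p (m + n) (x * y).
Proof.
have [->|x0] := eqVneq x 0; first by rewrite mul0r ratval_ge0.
have [->|y0] := eqVneq y 0; first by rewrite mulr0 ratval_ge0.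
by rewrite /ratval_ge (negPf x0) (negPf y0) mulf_eq0 (negPf x0) (negPf y0)
  ratvalM //=; exact: lerD.
Qed.

Lemma ratval_geN n x : ratval_ge p n x -> ratval_ge p n (- x).
Proof.
move=> h; rewrite -mulN1r -[n]add0r; apply: ratval_geM => //.
by rewrite /ratval_ge oppr_eq0 oner_eq0 /ratval (numq_int (-1)) (denq_int (-1)) subrr.
Qed.

Lemma ratval_geD n x y :
  ratval_ge p n x -> ratval_ge p n y -> ratval_ge p n (x + y).
Proof.
have dx0 := denq_neq0 x; have dy0 := denq_neq0 y.
have ex : x = (numq x * denq y)%:~R / (denq x * denq y)%:~R.
  rewrite !intrM invfM mulrACA divff ?intr_eq0 // mulr1.
  by rewrite divq_num_den.
have ey : y = (numq y * denq x)%:~R / (denq x * denq y)%:~R.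
  rewrite !intrM [in X in _ / X]mulrC invfM mulrACA divff ?intr_eq0 // mulr1.
  by rewrite divq_num_den.
set d := denq x * denq y in ex ey; rewrite {}ex {}ey.
rewrite -mulrDl -intrD !ratval_ge_frac ?mulf_neq0 //.
case: (_ + _) => // m; rewrite -!(dvdzE (p ^ m)%N%:Z) => ha hb.
exact: rpredD.
Qed.

Lemma ratval_geB n x y :
  ratval_ge p n x -> ratval_ge p n y -> ratval_ge p n (x - y).
Proof. by move=> hx /ratval_geN; exact: ratval_geD. Qed.

Lemma ratval_ge_ex x : exists b, ratval_ge p b x.
Proof. by exists (ratval p x); rewrite /ratval_ge lexx orbT. Qed.
End RatVal.

Section Padic.
Variable p : prime_number.

Definition padic_cauchy : pred (nat -> rat) := fun u =>
  `[< forall n : int, exists N : nat, forall i j : nat,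
        (N <= i)%N -> (N <= j)%N -> ratval_ge p n (u i - u j) >].

Lemma padic_cauchy_bounded (u : nat -> rat) : padic_cauchy u ->
  exists b, exists N, forall i, (N <= i)%N -> ratval_ge p b (u i).
Proof.
move=> /asboolP /(_ 0)[N hN]; have [b hb] := ratval_ge_ex p (u N).
exists (Order.min 0 b), N => i hi; rewrite -(subrK (u N) (u i)).
apply: ratval_geD; last by apply: ratval_ge_le hb; rewrite ge_min lexx orbT.
by apply: ratval_ge_le (hN _ _ hi (leqnn N)); rewrite ge_min lexx.
Qed.

Lemma padic_cauchy_cst (x : rat) : padic_cauchy (fun=> x).
Proof. by apply/asboolP => n; exists 0%N => *; rewrite subrr ratval_ge0. Qed.

Lemma padic_cauchy_subring : subring_closed padic_cauchy.
Proof.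
split; first exact: padic_cauchy_cst.
- move=> u v /asboolP hu /asboolP hv; apply/asboolP => n.
  have [N hN] := hu n; have [M hM] := hv n; exists (maxn N M) => i j.
  rewrite !geq_max => /andP[Ni Mi] /andP[Nj Mj].
  have -> : (u - v) i - (u - v) j = (u i - u j) - (v i - v j).
    by rewrite -[LHS]/((u i - v i) - (u j - v j)) !opprD addrACA.
  exact: ratval_geB (hN _ _ Ni Nj) (hM _ _ Mi Mj).
- move=> u v cu cv; have [b [B hb]] := padic_cauchy_bounded cu.
  have [c [C hc]] := padic_cauchy_bounded cv.
  move: cu cv => /asboolP hu /asboolP hv; apply/asboolP => n.
  have [N hN] := hu (n - c); have [M hM] := hv (n - b).
  exists (maxn (maxn N M) (maxn B C)) => i j.
  rewrite !geq_max => /andP[/andP[Ni Mi] /andP[Bi Ci]].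
  move=> /andP[/andP[Nj Mj] /andP[Bj Cj]].
  have -> : (u * v) i - (u * v) j = u i * (v i - v j) + (u i - u j) * v j.
    by rewrite mulrBr mulrBl addrA subrK.
  apply: ratval_geD.
    by rewrite -(subrKC b n); exact: ratval_geM (hb _ Bi) (hM _ _ Mi Mj).
  by rewrite -(subrK c n); exact: ratval_geM (hN _ _ Ni Nj) (hc _ Cj).
Qed.

HB.instance Definition _ :=
  GRing.isSubringClosed.Build (nat -> rat) padic_cauchy padic_cauchy_subring.

Record cauchy_seq := CauchySeq {
  cauchy_val :> nat -> rat;
  cauchy_valP : cauchy_val \in padic_cauchy }.

HB.instance Definition _ := [isSub for cauchy_val].
HB.instance Definition _ := [Choice of cauchy_seq by <:].
HB.instance Definition _ := [SubChoice_isSubComNzRing of cauchy_seq by <:].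

Definition padic_null : pred cauchy_seq := fun u =>
  `[< forall n : int, exists N : nat, forall i : nat,
        (N <= i)%N -> ratval_ge p n (u i) >].

Lemma padic_null_idealr : idealr_closed padic_null.
Proof.
split.
- by apply/asboolP => n; exists 0%N => i _; exact: ratval_ge0.
- apply/negP => /asboolP /(_ 1)[N /(_ N (leqnn N))].
  by rewrite -[cauchy_val _ _]/(1 : rat) ratval_ge1.
- move=> a u v /asboolP hu /asboolP hv; apply/asboolP => n.
  have [b [B hb]] := padic_cauchy_bounded (cauchy_valP a).
  have [N hN] := hu (n - b); have [M hM] := hv n.
  exists (maxn B (maxn N M)) => i; rewrite !geq_max => /and3P[Bi Ni Mi].
  rewrite -[cauchy_val _ _]/(a i * u i + v i).
  apply: ratval_geD (hM _ Mi); rewrite -(subrKC b n).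
  exact: ratval_geM (hb _ Bi) (hN _ Ni).
Qed.

HB.instance Definition _ :=
  isIdealr.Build cauchy_seq padic_null padic_null_idealr.

(* The completion of the rationals for the p-adic absolute value: Cauchy sequences
   modulo null sequences. *)
Definition Qp : Type := {ideal_quot (padic_null : idealr cauchy_seq)}.
HB.instance Definition _ := GRing.ComNzRing.on Qp.
HB.instance Definition _ := Quotient.on Qp.

Definition Qp_of_rat (x : rat) : Qp :=
  \pi_Qp (CauchySeq (padic_cauchy_cst x)).

(* n <= v_p(x), the valuation extended from the rationals by continuity; [n] may
   be negative, and v_p(0) = +oo *)
Definition padic_ge (n : int) (x : Qp) : Prop :=
  exists u : cauchy_seq, x = \pi_Qp u /\
    exists N : nat, forall i : nat, (N <= i)%N -> ratval_ge p n (u i).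

(* x = y mod p^n Z_p *)
Definition padic_congr (n : int) (x y : Qp) : Prop := padic_ge n (x - y).

Lemma Qp_of_rat_is_zmod_morphism : zmod_morphism Qp_of_rat.
Proof.
move=> x y; rewrite /Qp_of_rat -[RHS](rmorphB \pi_Qp).
by congr (\pi_Qp _); apply: val_inj.
Qed.
HB.instance Definition _ :=
  GRing.isZmodMorphism.Build rat Qp Qp_of_rat Qp_of_rat_is_zmod_morphism.

Lemma Qp_of_rat_is_monoid_morphism : monoid_morphism Qp_of_rat.
Proof.
split=> [|x y]; rewrite /Qp_of_rat.
  rewrite -[RHS](rmorph1 \pi_Qp).
  by congr (\pi_Qp _); apply: val_inj.
rewrite -[RHS](rmorphM \pi_Qp).
by congr (\pi_Qp _); apply: val_inj.
Qed.
HB.instance Definition _ :=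
  GRing.isMonoidMorphism.Build rat Qp Qp_of_rat Qp_of_rat_is_monoid_morphism.

Lemma padic_ge_pi (n : int) (u : cauchy_seq) : padic_ge n (\pi_Qp u) <->
  exists N : nat, forall i : nat, (N <= i)%N -> ratval_ge p n (u i).
Proof.
split; last by move=> h; exists u.
move=> [v [/eqP]]; rewrite -Quotient.idealrBE => /asboolP /(_ n)[N hN] [M hM].
exists (maxn N M) => i; rewrite geq_max => /andP[Ni Mi].
rewrite -(subrK (v i) (u i)); apply: ratval_geD (hM _ Mi).
exact: hN.
Qed.

Lemma padic_ge_rat (n : int) (x : rat) :
  padic_ge n (Qp_of_rat x) <-> ratval_ge p n x.
Proof.
rewrite padic_ge_pi; split=> [[N /(_ N (leqnn N))] //|h].
by exists 0%N.
Qed.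

Lemma padic_ge0 n : padic_ge n 0.
Proof. by rewrite -(rmorph0 Qp_of_rat) padic_ge_rat ratval_ge0. Qed.

Lemma padic_ge1 n : padic_ge n 1 <-> n <= 0.
Proof. by rewrite -(rmorph1 Qp_of_rat) padic_ge_rat ratval_ge1. Qed.

Lemma padic_ge_le m n x : m <= n -> padic_ge n x -> padic_ge m x.
Proof.
move=> mn [u [ux [N hN]]]; exists u; split => //; exists N => i /hN.
exact: ratval_ge_le.
Qed.

Lemma padic_geM m n x y :
  padic_ge m x -> padic_ge n y -> padic_ge (m + n) (x * y).
Proof.
move=> [u [-> [N hN]]] [v [-> [M hM]]]; rewrite -(rmorphM \pi_Qp).
apply/padic_ge_pi; exists (maxn N M) => i; rewrite geq_max => /andP[Ni Mi].
exact: ratval_geM (hN _ Ni) (hM _ Mi).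
Qed.

Lemma padic_geB n x y : padic_ge n x -> padic_ge n y -> padic_ge n (x - y).
Proof.
move=> [u [-> [N hN]]] [v [-> [M hM]]]; rewrite -(rmorphB \pi_Qp).
apply/padic_ge_pi; exists (maxn N M) => i; rewrite geq_max => /andP[Ni Mi].
exact: ratval_geB (hN _ Ni) (hM _ Mi).
Qed.

Lemma padic_geD n x y : padic_ge n x -> padic_ge n y -> padic_ge n (x + y).
Proof.
move=> hx hy; rewrite -[y]opprK -[- y]sub0r; apply: padic_geB => //.
by apply: padic_geB => //; exact: padic_ge0.
Qed.

Lemma padic_ge_ex x : exists b, padic_ge b x.
Proof.
rewrite -[x]reprK; have [b [N hN]] := padic_cauchy_bounded (cauchy_valP (repr x)).
by exists b; apply/padic_ge_pi; exists N.
Qed.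
End Padic.

Definition prodQp : Type := forall p : prime_number, Qp p.

HB.instance Definition _ := gen_eqMixin prodQp.
HB.instance Definition _ := gen_choiceMixin prodQp.

Section ProdQp.
Implicit Types a b c : prodQp.
Let zero : prodQp := fun=> 0.
Let one : prodQp := fun=> 1.
Let opp a : prodQp := fun p => - a p.
Let add a b : prodQp := fun p => a p + b p.
Let mul a b : prodQp := fun p => a p * b p.

Let addA : associative add.
Proof. by move=> a b c; apply: functional_extensionality_dep => p; exact: addrA. Qed.
Let addC : commutative add.
Proof. by move=> a b; apply: functional_extensionality_dep => p; exact: addrC. Qed.
Let add0 : left_id zero add.
Proof. by move=> a; apply: functional_extensionality_dep => p; exact: add0r. Qed.
Let addN : left_inverse zero opp add.
Proof. by move=> a; apply: functional_extensionality_dep => p; exact: addNr. Qed.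
HB.instance Definition _ := GRing.isZmodule.Build prodQp addA addC add0 addN.

Let mulA : associative mul.
Proof. by move=> a b c; apply: functional_extensionality_dep => p; exact: mulrA. Qed.
Let mulC : commutative mul.
Proof. by move=> a b; apply: functional_extensionality_dep => p; exact: mulrC. Qed.
Let mul1 : left_id one mul.
Proof. by move=> a; apply: functional_extensionality_dep => p; exact: mul1r. Qed.
Let mulDl : left_distributive mul add.
Proof. by move=> a b c; apply: functional_extensionality_dep => p; exact: mulrDl. Qed.
Let one_neq0 : one != 0.
Proof.
apply/eqP => /(congr1 (fun a : prodQp => a (@PrimeNumber 2 isT))) /eqP.
exact/negP/oner_neq0.
Qed.
HB.instance Definition _ :=
  GRing.Zmodule_isComNzRing.Build prodQp mulA mulC mul1 mulDl one_neq0.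
End ProdQp.

Definition val_bounded_below : pred prodQp := fun a =>
  `[< exists b : int, forall p : prime_number, padic_ge b (a p) >].

Lemma val_bounded_below_subring : subring_closed val_bounded_below.
Proof.
split.
- by apply/asboolP; exists 0 => p; apply/padic_ge1.
- move=> a b /asboolP[m hm] /asboolP[n hn]; apply/asboolP.
  exists (Order.min m n) => p; apply: padic_geB.
    by apply: padic_ge_le (hm p); rewrite ge_min lexx.
  by apply: padic_ge_le (hn p); rewrite ge_min lexx orbT.
- move=> a b /asboolP[m hm] /asboolP[n hn]; apply/asboolP.
  by exists (m + n) => p; exact: padic_geM.
Qed.

HB.instance Definition _ :=
  GRing.isSubringClosed.Build prodQp val_bounded_below val_bounded_below_subring.

Record bounded_seq := BoundedSeq {
  bounded_val : prodQp;
  bounded_valP : bounded_val \in val_bounded_below }.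

HB.instance Definition _ := [isSub for bounded_val].
HB.instance Definition _ := [Choice of bounded_seq by <:].
HB.instance Definition _ := [SubChoice_isSubComNzRing of bounded_seq by <:].

Definition val_to_infty : pred bounded_seq := fun a =>
  `[< forall n : int, for_almost_all_primes (fun p => padic_ge n (bounded_val a p)) >].

Lemma val_to_infty_idealr : idealr_closed val_to_infty.
Proof.
split.
- by apply/asboolP => n; exists 0%N => p _; exact: padic_ge0.
- apply/negP => /asboolP /(_ 1)[N hN].
  have [q Nq pq] := prime_above N.
  have /padic_ge1 // : padic_ge 1 (1 : Qp (PrimeNumber pq)).
  exact: (hN (PrimeNumber pq) (ltnW Nq)).
- move=> a u v /asboolP hu /asboolP hv; apply/asboolP => n.
  have [b hb] := asboolP _ (bounded_valP a).
  apply: for_almost_all_primesI (hu (n - b)) (hv n) => p up vp.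
  rewrite -[bounded_val _ _]/(bounded_val a p * bounded_val u p + bounded_val v p).
  apply: padic_geD vp; rewrite -(subrKC b n).
  exact: padic_geM.
Qed.

HB.instance Definition _ :=
  isIdealr.Build bounded_seq val_to_infty val_to_infty_idealr.

Definition Qp_infty : Type := {ideal_quot (val_to_infty : idealr bounded_seq)}.
HB.instance Definition _ := GRing.ComNzRing.on Qp_infty.
HB.instance Definition _ := Quotient.on Qp_infty.

(* The sequence [a] defines the element [x]; the values of [a] at finitely many
   primes are irrelevant. *)
Definition represents (a : prodQp) (x : Qp_infty) : Prop :=
  exists b : bounded_seq, x = \pi_Qp_infty b /\
    for_almost_all_primes (fun p => bounded_val b p = a p).

Record composition := Composition {
  comp_val :> seq nat;
  comp_valP : all (fun i => 0 < i)%N comp_val }.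

Definition weight (s : seq nat) : nat := sumn s.

(* [n] is indexed from 0: the summation indices are N >= n 0 > n 1 > ... >= 1. *)
Definition mhs (N : nat) (s : seq nat) : rat :=
  \sum_(n : {ffun 'I_(size s) -> 'I_N.+1} |
          [forall i, (0 < n i)%N] &&
          [forall i : 'I_(size s), forall j : 'I_(size s),
            (i < j)%N ==> (n j < n i)%N])
    \prod_(i < size s) ((n i)%:R ^+ nth 0%N s i)^-1.

Definition weighted_mhs (p : nat) (s : seq nat) : rat :=
  p%:R ^+ weight s * mhs p.-1 s.

(* When the weights tend to infinity, the sum is over a finite set; see
   [finite_weight_lt]. *)
Definition mhs_truncation (c : nat -> rat) (s : nat -> composition)
    (n : int) (p : nat) : rat :=
  \sum_(i \in [set i : nat | (weight (s i))%:Z < n]) c i * weighted_mhs p (s i).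

Definition weight_to_infty (s : nat -> composition) : Prop :=
  forall w : nat, exists N : nat, forall i : nat, (N <= i)%N -> (w <= weight (s i))%N.

Lemma finite_weight_lt (s : nat -> composition) (n : int) :
  weight_to_infty s -> finite_set [set i : nat | (weight (s i))%:Z < n].
Proof.
case: n => n hs; last first.
  by rewrite (_ : mkset _ = set0) //; apply/seteqP; split.
have [N hN] := hs n; apply: (sub_finite_set _ (finite_II N)) => i /= hi.
by rewrite ltnNge; apply/negP => /hN; rewrite leqNgt -ltz_nat hi.
Qed.

Definition has_mhs_expansion (a : prodQp) : Prop :=
  exists (c : nat -> rat) (s : nat -> composition),
    weight_to_infty s /\
    forall n : int, for_almost_all_primes (fun p =>
      padic_congr n (a p) (Qp_of_rat p (mhs_truncation c s n p))).

Definition weighted_MHS_algebra : set Qp_infty :=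
  [set x | exists a : bounded_seq, x = \pi_Qp_infty a /\ has_mhs_expansion (bounded_val a)].

Definition in_weighted_MHS_algebra (a : prodQp) : Prop :=
  exists x : Qp_infty, represents a x /\ weighted_MHS_algebra x.

(* Membership does not depend on the representative chosen above, and the
   sequences with an expansion automatically have valuation bounded below. *)
Lemma in_weighted_MHS_algebraP (a : prodQp) :
  in_weighted_MHS_algebra a <-> has_mhs_expansion a.
Proof.
split.
- move=> [_ [[b [-> ba]] [d [/eqP]]]]; rewrite -Quotient.idealrBE => /asboolP bd.
  move=> [c [s [hs hd]]]; exists c, s; split => // n.
  apply: for_almost_all_primesI ba (for_almost_all_primesI _ (bd n) (hd n)).
    by move=> p <-; exact: id.
  move=> p h1 h2; rewrite /padic_congr -(subrK (bounded_val d p) (bounded_val b p)) -addrA.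
  exact: padic_geD.
- move=> ha; have [c [s [hs hd]]] := ha; have [N hN] := hd 0.
  pose b : prodQp := fun p => if (N <= p)%N then a p else 0.
  have bB : b \in val_bounded_below.
    apply/asboolP; exists 0 => p; rewrite /b; case: ifP => [/hN|_].
      rewrite /padic_congr /mhs_truncation.
      rewrite (_ : mkset _ = set0) ?fsbig_set0 ?rmorph0 ?subr0 //.
      by apply/seteqP; split.
    exact: padic_ge0.
  have ba : for_almost_all_primes (fun p => b p = a p).
    by exists N => p Np; rewrite /b Np.
  exists (\pi_Qp_infty (BoundedSeq bB)); split; first by exists (BoundedSeq bB).
  exists (BoundedSeq bB); split => //; exists c, s; split => // n.
  apply: for_almost_all_primesI ba (hd n) => p /= e.
  by rewrite e.
Qed.

(* Main.v *)
Require Import Defs.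
From mathcomp Require Import all_boot all_order all_algebra.
From mathcomp Require Import boolp classical_sets fsbigop.
From mathcomp Require Import ring zify.
Set Implicit Arguments.
Unset Strict Implicit.
Unset Printing Implicit Defensive.
Import Order.TTheory GRing.Theory Num.Theory.
Local Open Scope ring_scope.

(** Write [h_k] for [p^k H_(p-1)(k)] and [s_k] for [p^k] times the sum of [n^-k] over
    [1 <= n <= (p-1)/2]. Splitting [1 .. p-1] into pairs [n, p - n], respectively into
    even numbers [2n] and odd numbers [p - 2n], and expanding [(p - n)^-k] and
    [(p - 2n)^-k] [p]-adically gives
      [h_k = s_k + (-1)^k sum_(i >= 0) C(k+i-1, i) s_(k+i)],
      [2^k h_k = s_k + (-1)^k sum_(i >= 0) C(k+i-1, i) 2^-i s_(k+i)].
    For even [k] the first relation has leading term [2 s_k], and the difference of the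
    two has leading term [(k/2) s_(k+1)]. Hence every [s_l] with [l >= 2] is a rational
    combination of [h_l], [h_(l-1)] and the [s_i] with [i > l]; iterating, and using
    that [s_i] is divisible by [p^i], [s_k] expands in the [h_m] alone. The alternating
    sum is [2^(1-k) s_k - h_k]. *)

(** * Estimates for p-adic valuations of rationals *)

Section Valuation.
Variable p : prime_number.

Lemma ratval_ge_sum (I : Type) (r : seq I) (P : pred I) (F : I -> rat) (n : int) :
  (forall i, P i -> ratval_ge p n (F i)) -> ratval_ge p n (\sum_(i <- r | P i) F i).
Proof.
move=> h; elim/big_rec: _ => [|i x Pi hx]; first exact: ratval_ge0.
exact: ratval_geD (h i Pi) hx.
Qed.

Lemma ratval_ge_nat (m : nat) : ratval_ge p 0 m%:R.
Proof.
elim: m => [|m ih]; first exact: ratval_ge0.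
by rewrite -natr1; apply: ratval_geD => //; rewrite ratval_ge1.
Qed.

Lemma ratval_geX (n : nat) (x : rat) :
  ratval_ge p 1 x -> ratval_ge p n (x ^+ n).
Proof.
move=> hx; elim: n => [|n ih]; first by rewrite expr0 ratval_ge1.
by rewrite exprS -add1n PoszD; apply: ratval_geM.
Qed.

(** A positive valuation of [1 - y] would force one on [1 = (1 - y) + y], so [1 - y] is nonzero of
    valuation at most 0. *)
Lemma ratval_ge_inv_1sub (y : rat) :
  ratval_ge p 1 y -> 1 - y != 0 /\ ratval_ge p 0 (1 - y)^-1.
Proof.
move=> hy; have n1 : ~ ratval_ge p 1 (1 - y).
  by move=> h; have := ratval_geD h hy; rewrite subrK ratval_ge1.
have y0 : 1 - y != 0 by apply/eqP => e; apply: n1; rewrite e ratval_ge0.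
split=> //; apply/orP; right.
have := ratvalM p y0 (invr_neq0 y0); rewrite divff // ratval1.
move/negP: n1; rewrite /ratval_ge (negPf y0) /= -ltNge; lia.
Qed.

Lemma ratval_ge_pdiv (d : nat) : (0 < d < p)%N -> ratval_ge p 1 (p%:R / d%:R).
Proof.
move=> /andP[d0 dp].
rewrite (ratval_ge_frac p 1 p%:Z (d := d%:Z)); last by lia.
rewrite (_ : logn p `|d%:Z| = 0%N) /=; first by rewrite expn1 dvdnn.
by rewrite lognE gtnNdvd // !andbF.
Qed.
End Valuation.

(** A prime larger than the denominator cannot divide it. Fixed rational coefficients therefore
    never spoil a congruence, up to finitely many primes. *)
Lemma ratval_ge0_const (c : rat) :
  for_almost_all_primes (fun p => ratval_ge p 0 c).
Proof.
exists `|denq c|.+1 => p hp; apply/orP; right; rewrite /ratval.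
rewrite (lognE p `|denq c|) gtnNdvd ?absz_gt0 ?denq_neq0 //.
by rewrite !andbF subr0.
Qed.

(** * Truncated negative binomial series *)

Definition negbin_coef (k i : nat) : rat := 'C((k + i).-1, i)%:R.

Lemma negbin_coefS (k i : nat) :
  negbin_coef k.+1 i.+1 = negbin_coef k i.+1 + negbin_coef k.+1 i.
Proof.
by rewrite /negbin_coef !addSn addnS /= -natrD -binS.
Qed.

Lemma negbin_coef0 (k : nat) : negbin_coef k 0 = 1.
Proof. by rewrite /negbin_coef bin0. Qed.

Lemma negbin_coef1 (k : nat) : negbin_coef k 1 = k%:R.
Proof. by rewrite /negbin_coef bin1 addn1. Qed.

(** Truncated form of [(1 - y) * (1 - y) ^- k.+1 = (1 - y) ^- k]: Pascal's rule cancels all but the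
    top term. *)
Lemma negbin_telescope (k n : nat) (y : rat) :
  (1 - y) * \sum_(i < n.+1) negbin_coef k.+1 i * y ^+ i =
  \sum_(i < n.+1) negbin_coef k i * y ^+ i - negbin_coef k.+1 n * y ^+ n.+1.
Proof.
elim: n => [|n ih]; first by rewrite !big_ord1 !negbin_coef0; ring.
rewrite big_ord_recr mulrDr ih [in RHS]big_ord_recr /= negbin_coefS.
rewrite (exprS y n.+1); ring.
Qed.

(** Induction on [k]: multiplication by [1 - y] turns the remainder for [k.+1] into the one for [k]
    plus an integer multiple of [y ^+ n]. *)
Lemma ratval_ge_negbin (p : prime_number) (k n : nat) (y : rat) :
  ratval_ge p 1 y ->
  ratval_ge p n ((1 - y)^-1 ^+ k - \sum_(i < n) negbin_coef k i * y ^+ i).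
Proof.
move=> hy; have [y0 hinv] := ratval_ge_inv_1sub hy.
case: n => [|n].
  rewrite big_ord0 subr0; elim: k => [|k ih]; first by rewrite ratval_ge1.
  by rewrite exprS; exact: (ratval_geM hinv ih).
elim: k => [|k ih].
  rewrite big_ord_recl big1 => [|i _].
    by rewrite negbin_coef0 !expr0 mulr1 addr0 subrr ratval_ge0.
  by rewrite /negbin_coef add0n bin_small ?mul0r //=.
rewrite -[\sum_(i < _) _](mulKf y0) negbin_telescope exprS -mulrBr -[Posz n.+1]add0r.
apply: ratval_geM => //; rewrite opprB addrCA addrC.
apply: ratval_geD; first exact: ih.
rewrite -[Posz n.+1]add0r; apply: ratval_geM; last exact: ratval_geX.
exact: ratval_ge_nat.
Qed.

(** * Reflection relations between full and half sums *)

Definition weighted_sum (p k : nat) : rat := p%:R ^+ k * \sum_(1 <= n < p) (n%:R ^+ k)^-1.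

Definition weighted_half (p k : nat) : rat :=
  p%:R ^+ k * \sum_(1 <= n < ((p - 1) %/ 2).+1) (n%:R ^+ k)^-1.

Lemma sum_even_odd (V : zmodType) (F : nat -> V) (q : nat) :
  \sum_(1 <= m < q.*2.+1) F m =
  \sum_(1 <= m < q.+1) F m.*2 + \sum_(1 <= m < q.+1) F m.*2.-1.
Proof.
elim: q => [|q ih]; first by rewrite !big_geq // addr0.
rewrite doubleS 2?big_nat_recr //= ih [in RHS]big_nat_recr //=.
by rewrite [X in _ = _ + X]big_nat_recr //= doubleS -addrA [F _ + F _]addrC addrACA.
Qed.

Lemma sum_even_odd_refl (V : zmodType) (F : nat -> V) (q : nat) :
  \sum_(1 <= m < q.*2.+1) F m =
  \sum_(1 <= m < q.+1) (F m.*2 + F (q.*2.+1 - m.*2)%N).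
Proof.
rewrite sum_even_odd big_split /=; congr (_ + _).
rewrite big_nat_rev /=; apply: eq_big_nat => m hm; congr F; lia.
Qed.

Lemma sum_refl (V : zmodType) (F : nat -> V) (q : nat) :
  \sum_(1 <= m < q.*2.+1) F m =
  \sum_(1 <= m < q.+1) (F m + F (q.*2.+1 - m)%N).
Proof.
rewrite (big_cat_nat (n := q.+1)) //=; last lia.
rewrite big_split /=; congr (_ + _).
rewrite big_nat_rev /= -{1}[q.+1]addn1 addnC big_addn.
have -> : (q.*2.+1 - q = q.+1)%N by lia.
by apply: eq_big_nat => m hm; congr F; lia.
Qed.

Lemma odd_primeE (p : prime_number) : (3 <= p)%N -> p = ((p - 1) %/ 2).*2.+1 :> nat.
Proof.
move=> hp; case/even_prime: (prime_valP p) => e; lia.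
Qed.

(** With [y = p / (t * m)], one has [p / (p - t * m) = - y / (1 - y)]; the [k]-th power is then
    expanded in [y]. The cases [t = 1] and [t = 2] serve the two reflections. *)
Lemma weighted_half_term (p : prime_number) (k n t m : nat) : (0 < t * m < p)%N ->
  ratval_ge p n (p%:R ^+ k * ((p - t * m)%:R ^+ k)^-1 -
    (-1) ^+ k * \sum_(i < n) negbin_coef k i * (p%:R / (t * m)%:R) ^+ (k + i)).
Proof.
move=> hd; set d := (t * m)%N in hd *; set y := p%:R / d%:R.
have hy : ratval_ge p 1 y by exact: ratval_ge_pdiv.
have d0 : d%:R != 0 :> rat by rewrite pnatr_eq0; lia.
have -> : p%:R ^+ k * ((p - d)%:R ^+ k)^-1 = (-1) ^+ k * y ^+ k * (1 - y)^-1 ^+ k.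
  rewrite -exprVn -!exprMn natrB; last lia.
  have pd0 : p%:R - d%:R != 0 :> rat by rewrite subr_eq0 eqr_nat; lia.
  have dp0 : d%:R - p%:R != 0 :> rat by rewrite -opprB oppr_eq0.
  by congr (_ ^+ k); rewrite /y; field; rewrite d0 ?pd0 ?dp0.
have -> : (-1) ^+ k * \sum_(i < n) negbin_coef k i * y ^+ (k + i) =
    (-1) ^+ k * y ^+ k * \sum_(i < n) negbin_coef k i * y ^+ i.
  by rewrite !mulr_sumr; apply: eq_bigr => i _; rewrite exprD; ring.
rewrite -mulrBr -[Posz n]add0r; apply: ratval_geM; last exact: ratval_ge_negbin.
apply: (@ratval_ge_le p 0 k%:Z) => //.
rewrite -exprMn mulN1r; apply: ratval_geX; exact: ratval_geN.
Qed.

Lemma weighted_half_refl (p : prime_number) (k n t : nat) :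
  (0 < t)%N -> (t * ((p - 1) %/ 2) < p)%N ->
  ratval_ge p n
    (p%:R ^+ k * \sum_(1 <= m < ((p - 1) %/ 2).+1) ((p - t * m)%:R ^+ k)^-1 -
     (-1) ^+ k * \sum_(i < n)
       negbin_coef k i * t%:R ^- (k + i) * weighted_half p (k + i)).
Proof.
move=> t0 ht.
have -> : (-1) ^+ k * \sum_(i < n)
       negbin_coef k i * t%:R ^- (k + i) * weighted_half p (k + i) =
    \sum_(1 <= m < ((p - 1) %/ 2).+1)
      (-1) ^+ k * \sum_(i < n) negbin_coef k i * (p%:R / (t * m)%:R) ^+ (k + i).
  rewrite -mulr_sumr exchange_big /=; congr (_ * _); apply: eq_bigr => i _.
  rewrite /weighted_half !mulr_sumr; apply: eq_bigr => m _.
  by rewrite natrM invfM !exprMn !exprVn; ring.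
rewrite mulr_sumr -sumrB big_nat_cond; apply: ratval_ge_sum => m /andP[hm _].
apply: weighted_half_term; rewrite muln_gt0 t0 /=; nia.
Qed.

Lemma weighted_sum_refl (p : prime_number) (k n : nat) : (3 <= p)%N ->
  ratval_ge p n (weighted_sum p k -
    (weighted_half p k + (-1) ^+ k * \sum_(i < n) negbin_coef k i * weighted_half p (k + i))).
Proof.
move=> hp; have e := odd_primeE hp; have ht : (1 * ((p - 1) %/ 2) < p)%N by lia.
move: (weighted_half_refl k n (ltn0Sn 0) ht).
rewrite (eq_bigr (fun i : 'I_n => negbin_coef k i * weighted_half p (k + i))); last first.
  by move=> i _; rewrite expr1n invr1 mulr1.
suff -> : weighted_sum p k = weighted_half p k + p%:R ^+ k *
    \sum_(1 <= m < ((p - 1) %/ 2).+1) ((p - 1 * m)%:R ^+ k)^-1.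
  by rewrite opprD addrACA subrr add0r.
rewrite /weighted_sum /weighted_half -mulrDr -big_split {2}e sum_refl -e; congr (_ * _).
by apply: eq_bigr => m _; rewrite mul1n.
Qed.

Lemma weighted_sum_even_odd (p : prime_number) (k n : nat) : (3 <= p)%N ->
  ratval_ge p n (weighted_sum p k -
    (2%:R ^- k * weighted_half p k + (-1) ^+ k *
      \sum_(i < n) negbin_coef k i * 2%:R ^- (k + i) * weighted_half p (k + i))).
Proof.
move=> hp; have e := odd_primeE hp; have ht : (2 * ((p - 1) %/ 2) < p)%N by lia.
move: (weighted_half_refl k n (ltn0Sn 1) ht).
suff -> : weighted_sum p k = 2%:R ^- k * weighted_half p k + p%:R ^+ k *
    \sum_(1 <= m < ((p - 1) %/ 2).+1) ((p - 2 * m)%:R ^+ k)^-1.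
  by rewrite opprD addrACA subrr add0r.
rewrite /weighted_sum /weighted_half mulrCA -mulrDr.
rewrite [2%:R ^- k * _]mulr_sumr -big_split {2}e sum_even_odd_refl -e.
congr (_ * _).
by apply: eq_bigr => m _; rewrite -mul2n natrM exprMn invfM.
Qed.

(** The alternating sum is twice its even part minus the full sum. *)
Lemma alternating_sum (p : prime_number) (k : nat) : (3 <= p)%N ->
  p%:R ^+ k * \sum_(1 <= n < p) ((-1) ^+ n / n%:R ^+ k) =
  2%:R * 2%:R ^- k * weighted_half p k - weighted_sum p k.
Proof.
move=> hp; have e := odd_primeE hp; rewrite /weighted_sum /weighted_half.
rewrite [X in _ * X = _](_ : _ =
    2%:R * 2%:R ^- k * (\sum_(1 <= m < ((p - 1) %/ 2).+1) (m%:R ^+ k)^-1) -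
    \sum_(1 <= m < p) (m%:R ^+ k)^-1); first by ring.
rewrite {1 3}e !sum_even_odd; set q := (_ %/ 2)%N.
have -> : \sum_(1 <= m < q.+1) ((-1) ^+ m.*2 / m.*2%:R ^+ k) =
    2%:R ^- k * \sum_(1 <= m < q.+1) (m%:R ^+ k)^-1 :> rat.
  rewrite mulr_sumr; apply: eq_bigr => m _.
  by rewrite -signr_odd odd_double -mul2n natrM exprMn invfM mul1r.
have -> : \sum_(1 <= m < q.+1) ((-1) ^+ m.*2.-1 / m.*2.-1%:R ^+ k) =
    - \sum_(1 <= m < q.+1) (m.*2.-1%:R ^+ k)^-1 :> rat.
  rewrite -sumrN; apply: eq_big_nat => m /andP[m0 _].
  rewrite -signr_odd (_ : odd _ = true) ?expr1 ?mulN1r //.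
  by rewrite -subn1 oddB ?odd_double // double_gt0.
have -> : \sum_(1 <= m < q.+1) (m.*2%:R ^+ k)^-1 =
    2%:R ^- k * \sum_(1 <= m < q.+1) (m%:R ^+ k)^-1 :> rat.
  rewrite mulr_sumr; apply: eq_bigr => m _.
  by rewrite -mul2n natrM exprMn invfM.
ring.
Qed.

Lemma weighted_sum_ge (p : prime_number) (k : nat) : ratval_ge p k (weighted_sum p k).
Proof.
rewrite /weighted_sum mulr_sumr big_nat_cond; apply: ratval_ge_sum => m /andP[hm _].
by rewrite -exprVn -exprMn; apply: ratval_geX; exact: ratval_ge_pdiv.
Qed.

Lemma weighted_half_ge (p : prime_number) (k : nat) : ratval_ge p k (weighted_half p k).
Proof.
rewrite /weighted_half mulr_sumr big_nat_cond; apply: ratval_ge_sum => m /andP[hm _].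
rewrite -exprVn -exprMn; apply: ratval_geX; apply: ratval_ge_pdiv.
have := prime_gt1 (prime_valP p); lia.
Qed.

(** * Congruences for almost all primes and elimination of half sums *)

Definition pval_ge (n : nat) (f : prime_number -> rat) : Prop :=
  for_almost_all_primes (fun p => ratval_ge p n (f p)).

Lemma pval_ge_le m n f : (m <= n)%N -> pval_ge n f -> pval_ge m f.
Proof. by move=> mn; apply: for_almost_all_primesW => p; exact: ratval_ge_le. Qed.

Lemma pval_ge_eq n f g :
  for_almost_all_primes (fun p => f p = g p) -> pval_ge n f -> pval_ge n g.
Proof. by apply: for_almost_all_primesI => p ->. Qed.

Lemma pval_geD n f g : pval_ge n f -> pval_ge n g -> pval_ge n (fun p => f p + g p).
Proof. by apply: for_almost_all_primesI => p; exact: ratval_geD. Qed.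

Lemma pval_geZ n c f : pval_ge n f -> pval_ge n (fun p => c * f p).
Proof.
apply: for_almost_all_primesI (ratval_ge0_const c) => p hc hf.
by rewrite -[Posz n]add0r; exact: ratval_geM.
Qed.

Lemma pval_ge_sum n (I : Type) (r : seq I) (P : pred I)
    (f : I -> prime_number -> rat) :
  (forall i, P i -> pval_ge n (f i)) ->
  pval_ge n (fun p => \sum_(i <- r | P i) f i p).
Proof.
move=> h; elim: r => [|i r ih].
  by exists 0%N => p _; rewrite big_nil ratval_ge0.
have [Pi|Pi] := boolP (P i); last first.
  by apply: pval_ge_eq ih; exists 0%N => p _; rewrite big_cons (negPf Pi).
apply: pval_ge_eq (pval_geD (h i Pi) ih).
by exists 0%N => p _; rewrite big_cons Pi.
Qed.

(* The even case reads off [weighted_sum_refl]; in the odd case the weight [l - 1]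
   instances of [weighted_sum_refl] and of [2 ^+ (l - 1)] times [weighted_sum_even_odd]
   have the same leading term, so their difference starts with [weighted_half p l]. *)
Lemma weighted_half_elim (l : nat) : (2 <= l)%N ->
  exists (a b : rat) (r : nat -> rat), forall n : nat,
    pval_ge n (fun p => weighted_half p l -
      (a * weighted_sum p l + b * weighted_sum p l.-1 +
       \sum_(i < n) r i * weighted_half p (l + i.+1))).
Proof.
move=> hl; have [ol|el] := boolP (odd l); last first.
  exists 2%:R^-1, 0, (fun i => - 2%:R^-1 * negbin_coef l i.+1) => n.
  (* The term [i = 0] merges with the leading half sum, so [n.+1] terms are needed to leave a tail
     of [n]. *)
  apply: (@pval_ge_le _ n.+1) => //.
  have h : pval_ge n.+1 (fun p => weighted_sum p l -
      (weighted_half p l +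
       (-1) ^+ l * \sum_(i < n.+1) negbin_coef l i * weighted_half p (l + i))).
    by exists 3%N => p hp; exact: weighted_sum_refl.
  apply: pval_ge_eq (pval_geZ (- 2%:R^-1) h); exists 0%N => p _.
  rewrite big_ord_recl negbin_coef0 addn0 -signr_odd (negPf el) expr0 !mul1r.
  rewrite -(eq_bigr _ (fun i _ => mulrA _ _ _)) -mulr_sumr.
  by rewrite /=; field.
case: l hl ol => [//|K] /= hK oK; have K0 : (0 < K)%N by lia.
have nK : K%:R != 0 :> rat by rewrite pnatr_eq0 -lt0n.
(* Coefficients left after subtracting [2 ^+ K] times the second relation from the first. Since
   [g 0 = 0] and [g 1 = K / 2], solving for the term [i = 1] brings in the factor [2 / K] and a
   shift of the tail by two. *)
pose g i := negbin_coef K i * (1 - 2%:R ^- i).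
exists 0, (2%:R / K%:R * (1 - 2%:R ^+ K)), (fun i => - (2%:R / K%:R) * g i.+2) => n.
apply: (@pval_ge_le _ n.+2); first by lia.
have h1 : pval_ge n.+2 (fun p => weighted_sum p K -
    (weighted_half p K +
     (-1) ^+ K * \sum_(i < n.+2) negbin_coef K i * weighted_half p (K + i))).
  by exists 3%N => p hp; exact: weighted_sum_refl.
have h2 : pval_ge n.+2 (fun p => weighted_sum p K -
    (2%:R ^- K * weighted_half p K + (-1) ^+ K *
      \sum_(i < n.+2) negbin_coef K i * 2%:R ^- (K + i) * weighted_half p (K + i))).
  by exists 3%N => p hp; exact: weighted_sum_even_odd.
apply: pval_ge_eq (pval_geZ (- (2%:R / K%:R))
  (pval_geD h1 (pval_geZ (- 2%:R ^+ K) h2))); exists 0%N => p _.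
have e2 : 2%:R ^+ K != 0 :> rat by rewrite expf_neq0.
rewrite -signr_odd (negPf oK) expr0 !mul1r.
have -> : \sum_(i < n.+2) negbin_coef K i * 2%:R ^- (K + i) * weighted_half p (K + i) =
    2%:R ^- K * (\sum_(i < n.+2) negbin_coef K i * weighted_half p (K + i) -
      \sum_(i < n.+2) g i * weighted_half p (K + i)).
  rewrite -sumrB mulr_sumr; apply: eq_bigr => i _.
  rewrite /g exprD invfM; ring.
set T := \sum_(i < n.+2) negbin_coef K i * _; rewrite !big_ord_recl /=.
rewrite {1}/g expr0 invr1 subrr mulr0 mul0r add0r {1}/g negbin_coef1 expr1 addn1.
have -> : \sum_(i < n) - (2%:R / K%:R) * g i.+2 * weighted_half p (K.+1 + i.+1) =
    - (2%:R / K%:R) * \sum_(i < n) g i.+2 * weighted_half p (K + i.+2).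
  by rewrite mulr_sumr; apply: eq_bigr => i _; rewrite addSnnS; ring.
by rewrite /bump /=; field; rewrite nK.
Qed.

(* Coefficient of [weighted_half p i], for [i >= m + 2], once the [weighted_half p j]
   with [2 <= j <= m + 1] have been eliminated from [weighted_half p k]; here [r l j]
   is the coefficient of [weighted_half p (l + 3 + j)] in the relation eliminating
   [weighted_half p (l + 2)]. The values for [i < m + 2] are meaningless. *)
Fixpoint elim_coef (r : nat -> nat -> rat) (k m i : nat) : rat :=
  if m is m'.+1 then
    elim_coef r k m' i + elim_coef r k m' m'.+2 * r m' (i - m'.+3)%N
  else (i == k)%:R.

(** Induction on [m]: the first term of the tail, [weighted_half p m.+2], is replaced using its own
    relation. The hypothesis is taken at [n.+1] to make up for that term. *)
Lemma weighted_half_elim_iter (a b : nat -> rat) (r : nat -> nat -> rat) (k m n : nat) :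
    (2 <= k)%N ->
    (forall l n, pval_ge n (fun p => weighted_half p l.+2 -
      (a l * weighted_sum p l.+2 + b l * weighted_sum p l.+1 +
       \sum_(i < n) r l i * weighted_half p (l.+2 + i.+1)))) ->
  pval_ge n (fun p => weighted_half p k -
    (\sum_(l < m) elim_coef r k l l.+2 *
       (a l * weighted_sum p l.+2 + b l * weighted_sum p l.+1) +
     \sum_(i < n) elim_coef r k m (m.+2 + i) * weighted_half p (m.+2 + i))).
Proof.
move=> hk hr; elim: m n => [|m ih] n.
  have [kn|nk] := ltnP (k - 2) n.
    exists 0%N => p _; rewrite big_ord0 add0r (bigD1 (Ordinal kn)) //= big1.
      by rewrite subnKC // eqxx mul1r addr0 subrr ratval_ge0.
    move=> i /eqP ik; rewrite (_ : (_ == k) = false) ?mul0r //.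
    by apply/eqP => e; apply: ik; apply: val_inj => /=; lia.
  (* Here [k] lies beyond the truncated range, and [weighted_half p k] is itself divisible by
     [p ^ n]. *)
  exists 0%N => p _; rewrite big_ord0 add0r big1 ?subr0.
    by apply: ratval_ge_le (weighted_half_ge p k); lia.
  move=> i _ /=; rewrite (_ : (_ == k) = false) ?mul0r //.
  by have := ltn_ord i; lia.
apply: pval_ge_eq (pval_geD (pval_ge_le (leqnSn n) (ih n.+1))
  (pval_geZ (elim_coef r k m m.+2) (hr m n))).
exists 0%N => p _; rewrite big_ord_recl big_ord_recr /= addn0.
have -> : \sum_(i < n) (elim_coef r k m (m.+3 + i) +
      elim_coef r k m m.+2 * r m (m.+3 + i - m.+3)%N) * weighted_half p (m.+3 + i) =
    \sum_(i < n) elim_coef r k m (m.+2 + bump 0 i) * weighted_half p (m.+2 + bump 0 i) +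
    elim_coef r k m m.+2 * \sum_(i < n) r m i * weighted_half p (m.+2 + i.+1).
  rewrite mulr_sumr -big_split; apply: eq_bigr => i _ /=.
  by rewrite addKn /bump /= add1n addSnnS mulrDl mulrA.
ring.
Qed.

(** * Expansions in depth one *)

(* [d i] is the coefficient of the composition [(i + 1)], so that [i < n.-1] selects
   the weights less than [n]. *)
Definition has_depth_one_expansion (f : prime_number -> rat) : Prop :=
  exists d : nat -> rat, forall n : nat,
    pval_ge n (fun p => f p - \sum_(i < n.-1) d i * weighted_sum p i.+1).

Lemma weighted_half_expansion (k : nat) :
  (2 <= k)%N -> has_depth_one_expansion (fun p => weighted_half p k).
Proof.
(* All relations are chosen once, so that the resulting coefficients do not depend on [n]. *)
move=> hk; have /choice[v hv] : forall l, exists v : rat * rat * (nat -> rat),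
    forall n, pval_ge n (fun p => weighted_half p l.+2 -
      (v.1.1 * weighted_sum p l.+2 + v.1.2 * weighted_sum p l.+1 +
       \sum_(i < n) v.2 i * weighted_half p (l.+2 + i.+1))).
  move=> l; have [a [b [r h]]] := @weighted_half_elim l.+2 isT.
  by exists (a, b, r).
pose a l := (v l).1.1; pose b l := (v l).1.2; pose r l := (v l).2.
pose e l := elim_coef r k l l.+2.
(* [weighted_sum p j.+1] arises from step [j] through [b] and from step [j.-1] through [a]; [t] is
   the shifted second contribution, zero at [j = 0]. *)
pose t N := if N is N'.+1 then e N' * a N' else 0.
exists (fun j => e j * b j + t j) => n.
have reidx p : \sum_(l < n) e l * (a l * weighted_sum p l.+2 + b l * weighted_sum p l.+1) =
    \sum_(j < n) (e j * b j + t j) * weighted_sum p j.+1 + t n * weighted_sum p n.+1.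
  elim: (n) => [|N ih]; first by rewrite !big_ord0 mul0r addr0.
  by rewrite !big_ord_recr ih /=; ring.
have h : pval_ge n (fun p => t n * weighted_sum p n.+1 +
    \sum_(i < n) elim_coef r k n (n.+2 + i) * weighted_half p (n.+2 + i)).
  apply: pval_geD.
    by apply: pval_geZ; exists 0%N => p _; apply: ratval_ge_le (weighted_sum_ge p _); lia.
  apply: pval_ge_sum => i _; apply: pval_geZ; exists 0%N => p _.
  by apply: ratval_ge_le (weighted_half_ge p _); lia.
have h' : pval_ge n (fun p => weighted_half p k -
    \sum_(j < n) (e j * b j + t j) * weighted_sum p j.+1).
  apply: pval_ge_eq (pval_geD (@weighted_half_elim_iter a b r k n n hk hv) h).
  by exists 0%N => p _; rewrite reidx; ring.
(* The required truncation keeps weights below the modulus exponent, so the top term, of weight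
   equal to it, is absorbed into the error. *)
case: n {reidx h} h' => [|n] h' /=; first by [].
have hn : pval_ge n.+1 (fun p => (e n * b n + t n) * weighted_sum p n.+1).
  by apply: pval_geZ; exists 0%N => p _; exact: weighted_sum_ge.
apply: pval_ge_eq (pval_geD h' hn).
by exists 0%N => p _; rewrite big_ord_recr /=; ring.
Qed.

Lemma weighted_sum_expansion (k : nat) :
  (0 < k)%N -> has_depth_one_expansion (fun p => weighted_sum p k).
Proof.
move=> k0; exists (fun i => (i.+1 == k)%:R) => n; exists 0%N => p _.
have [kn|nk] := ltnP k.-1 n.-1.
  rewrite (bigD1 (Ordinal kn)) //= prednK // eqxx mul1r big1 ?addr0 ?subrr.
    exact: ratval_ge0.
  move=> i /eqP ik; rewrite (_ : (_ == k) = false) ?mul0r //.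
  by apply/eqP => e; apply: ik; apply: val_inj => /=; lia.
rewrite big1 ?subr0 => [|i _]; first by apply: ratval_ge_le (weighted_sum_ge p k); lia.
by rewrite (_ : (_ == k) = false) ?mul0r //; have := ltn_ord i; lia.
Qed.

Lemma has_depth_one_expansion_lin (x y : rat) (f g : prime_number -> rat) :
  has_depth_one_expansion f -> has_depth_one_expansion g ->
  has_depth_one_expansion (fun p => x * f p + y * g p).
Proof.
move=> [d hd] [e he]; exists (fun i => x * d i + y * e i) => n.
apply: pval_ge_eq (pval_geD (pval_geZ x (hd n)) (pval_geZ y (he n))).
exists 0%N => p _; rewrite [in RHS](eq_bigr (fun i : 'I_n.-1 =>
  x * (d i * weighted_sum p i.+1) + y * (e i * weighted_sum p i.+1))) => [|i _];
  last by rewrite mulrDl !mulrA.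
by rewrite big_split -!mulr_sumr /=; ring.
Qed.

(** * From depth-one expansions to the weighted MHS algebra *)

Lemma mhs_singleton (N k : nat) : mhs N [:: k] = \sum_(1 <= m < N.+1) (m%:R ^+ k)^-1.
Proof.
rewrite /mhs /=.
rewrite (reindex (fun m : 'I_N.+1 => [ffun _ : 'I_1 => m])) /=; last first.
  exists (fun f : {ffun 'I_1 -> 'I_N.+1} => f ord0) => [m _|f _].
    by rewrite ffunE.
  by apply/ffunP => i; rewrite ffunE (ord1 i).
rewrite (big_nat_widenl 1 0) // big_mkord; apply: eq_big => [m|m _].
  rewrite andTb; apply/andP/idP => [[/forallP/(_ ord0)]|m0]; first by rewrite ffunE.
  split; first by apply/forallP => i; rewrite ffunE.
  by apply/forallP => i; apply/forallP => j; rewrite !(ord1 i) !(ord1 j).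
by rewrite big_ord1 ffunE.
Qed.

Lemma weighted_mhs_singleton (p : prime_number) (k : nat) :
  weighted_mhs p [:: k] = weighted_sum p k.
Proof.
rewrite /weighted_mhs /weighted_sum mhs_singleton /weight /= addn0 prednK //.
exact: prime_gt0 (prime_valP p).
Qed.

Definition singleton_comp (i : nat) : composition := @Composition [:: i.+1] isT.

Lemma depth_one_expansion_in_MHS (f : prime_number -> rat) :
  has_depth_one_expansion f ->
  in_weighted_MHS_algebra (fun p => Qp_of_rat p (f p)).
Proof.
move=> [d hd]; apply/in_weighted_MHS_algebraP; exists d, singleton_comp; split.
  by move=> w; exists w => i wi; rewrite /weight /= addn0 ltnW.
have trunc n p : mhs_truncation d singleton_comp (Posz n) p =
    \sum_(i < n.-1) d i * weighted_mhs p [:: i.+1].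
  rewrite /mhs_truncation (_ : mkset _ = `I_n.-1)%classic; last first.
    by apply/seteqP; split=> i /=; rewrite /weight /= ltz_nat; lia.
  exact: (esym (fsbig_ord _ n.-1 (fun i => d i * weighted_mhs p [:: i.+1]))).
(* For negative exponents the truncation is empty, and the expansion at exponent 0 already gives
   integrality. *)
case=> n; last first.
  apply: for_almost_all_primesW (hd 0%N) => p h; rewrite /padic_congr -rmorphB.
  rewrite big_ord0 in h; apply/padic_ge_rat; rewrite /mhs_truncation.
  rewrite (_ : mkset _ = set0)%classic; last by apply/seteqP; split.
  by rewrite fsbig_set0; apply: ratval_ge_le h.
apply: for_almost_all_primesW (hd n) => p h; rewrite /padic_congr -rmorphB.
apply/padic_ge_rat; rewrite trunc.
by under eq_bigr do rewrite weighted_mhs_singleton.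
Qed.

Theorem theorem5 (k : nat) (hk : (2 <= k)%N) :
  in_weighted_MHS_algebra (fun p : prime_number =>
    Qp_of_rat p (p%:R ^+ k * \sum_(1 <= n < ((p - 1) %/ 2).+1) (n%:R ^+ k)^-1)) /\
  in_weighted_MHS_algebra (fun p : prime_number =>
    Qp_of_rat p (p%:R ^+ k * \sum_(1 <= n < p) ((-1) ^+ n / n%:R ^+ k))).
Proof.
have hw := weighted_half_expansion hk; split; first exact: depth_one_expansion_in_MHS.
have [d hd] := has_depth_one_expansion_lin (2%:R * 2%:R ^- k) (-1) hw
  (weighted_sum_expansion (ltnW hk)).
apply: depth_one_expansion_in_MHS; exists d => n; apply: pval_ge_eq (hd n).
by exists 3%N => p hp; rewrite alternating_sum // mulN1r.
Qed.
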